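(* Let $p\ge 3$ be an integer. Then: (1) $\operatorname{ex}(4p+1,4K_p)=\binom{4p+1}{2}-15$; (2) $\operatorname{ex}(4p+2,4K_p)=\binom{4p+2}{2}-21$; (3) $\operatorname{ex}(4p+3,4K_p)=\binom{4p+3}{2}-28$; (4) $\operatorname{ex}(4p+4,4K_p)=\binom{4p+4}{2}-35$ if $p=3$, and $\operatorname{ex}(4p+4,4K_p)=\binom{4p+4}{2}-36$ if $p\ge 4$; (5) for every integer $n$ with $4p+5\le n\le 7p-2$, $\operatorname{ex}(n,4K_p)=\binom{n}{2}-7(n-4p+1)$, and for every integer $n\ge 7p-1$, $\operatorname{ex}(n,4K_p)=3+3(n-3)+t_{n-3,p-1}$.
   Context: All graphs are finite and simple. For a graph $H$, the Turán number $\operatorname{ex}(n,H)$ is the maximum number of edges in an $n$-vertex graph containing no subgraph isomorphic to $H$. $K_p$ is the complete graph on $p$ vertices and $4K_p$ denotes the disjoint union of four copies of $K_p$. $T_{m,q}$ denotes the complete $q$-partite graph on $m$ vertices whose part sizes differ by at most one (the Turán graph), and $t_{m,q}$ is its number of edges. *)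

(* Defs.v *)
From HB Require Import structures.
From mathcomp Require Import all_boot zify.

Set Implicit Arguments.
Unset Strict Implicit.
Unset Printing Implicit Defensive.

Record sgraph (V : finType) := SGraph {
  edges : {set {set V}};
  _ : [forall e in edges, #|e| == 2] }.

HB.instance Definition _ (V : finType) := [isSub for @edges V].
HB.instance Definition _ (V : finType) := [Finite of sgraph V by <:].

Definition nedges (V : finType) (G : sgraph V) : nat := #|edges G|.

Definition adj (V : finType) (G : sgraph V) (x y : V) : bool :=
  [set x; y] \in edges G.

(* Not necessarily induced. *)
Definition has_subgraph (W V : finType) (H : sgraph W) (G : sgraph V) : bool :=
  [exists f : {ffun W -> V},
    injectiveb f && [forall x, forall y, adj H x y ==> adj G (f x) (f y)]].

(* The value is 0 when no graph on n vertices is H-free; this happens only for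
   an edgeless H with at most n vertices. *)
Definition ex_num (n : nat) (W : finType) (H : sgraph W) : nat :=
  \max_(G : sgraph 'I_n | ~~ has_subgraph H G) nedges G.

Lemma complete_graph_subproof (V : finType) :
  [forall e in [set e : {set V} | #|e| == 2], #|e| == 2].
Proof. by apply/forall_inP => e; rewrite inE. Qed.

Definition complete_graph (V : finType) : sgraph V :=
  SGraph (complete_graph_subproof V).

Definition K (p : nat) : sgraph 'I_p := complete_graph 'I_p.

Lemma copies_subproof (k : nat) (W : finType) (H : sgraph W) :
  [forall e in [set pair i @: e | i : 'I_k, e : {set W} in edges H],
     #|e| == 2].
Proof.
apply/forall_inP => _ /imset2P [i e _ eH ->].
case: H eH => E /= /forall_inP hE /hE h.
by rewrite card_imset // => x y [].
Qed.

Definition copies (k : nat) (W : finType) (H : sgraph W) :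
    sgraph ('I_k * W)%type :=
  SGraph (copies_subproof k H).

Lemma multipartite_subproof (V : finType) (c : V -> nat) :
  [forall e in [set e : {set V} |
       [exists x, exists y, (c x != c y) && (e == [set x; y])]], #|e| == 2].
Proof.
apply/forall_inP => e; rewrite inE => /existsP [x /existsP [y /andP [cxy /eqP ->]]].
by rewrite cards2; have [xy|//] := eqVneq x y; rewrite xy eqxx in cxy.
Qed.

(* The parts are the fibres of c. *)
Definition complete_multipartite (V : finType) (c : V -> nat) : sgraph V :=
  SGraph (multipartite_subproof c).

(* The q parts are the residue classes modulo q (for q > 0); turan_partsP
   checks that their sizes differ by at most one. *)
Definition turan_graph (m q : nat) : sgraph 'I_m :=
  complete_multipartite (fun x : 'I_m => x %% q).

Definition turan_edges (m q : nat) : nat := nedges (turan_graph m q).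

Lemma turan_partsP (m q i j : nat) : i < q -> j < q ->
  #|[set x : 'I_m | x %% q == i]| <= #|[set x : 'I_m | x %% q == j]| + 1.
Proof.
move=> iq jq.
have q0 : 0 < q by apply: leq_trans iq.
have card_class k : k < q ->
    #|[set x : 'I_m | x %% q == k]| = m %/ q + (k < m %% q).
  move=> kq; rewrite -sum1dep_card -(big_mkord (fun x => x %% q == k) (fun=> 1)).
  elim: m => [|n IHn]; first by rewrite big_geq // div0n mod0n.
  rewrite big_mkcond big_nat_recr //= -big_mkcond IHn {IHn}.
  have nq := ltn_pmod n q0; rewrite divnS // modnS.
  case: (boolP (q %| n.+1)) => [|].
    rewrite /dvdn -addn1 -modnDml addn1 => h.
    have e : (n %% q).+1 = q.
      have := nq; rewrite leq_eqVlt => /orP [/eqP //|lt].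
      by rewrite modn_small in h.
    by case: eqP => ?; lia.
  rewrite /dvdn -addn1 -modnDml addn1 => h.
  have lt : (n %% q).+1 < q.
    by rewrite ltn_neqAle nq andbT; apply: contraNneq h => ->; rewrite modnn.
  by case: eqP => ?; lia.
rewrite !card_class // -addnA leq_add2l.
by case: (i < _) => //; rewrite addn1.
Qed.

(* Main.v *)
Require Import Defs.
From mathcomp Require Import all_boot zify.

Set Implicit Arguments.
Unset Strict Implicit.
Unset Printing Implicit Defensive.

(** In the complement F of the graph one looks for k = 4 disjoint independent
sets of size p.  Writing e(F) for the number of edges and n for the number of
vertices, the bulk of the theorem is the statement that k such sets exist as
soon as e(F) < a (n - k + 1) - (p - 1) a (a + 1) / 2 for some a >= 2 k - 1,
which is the tangent line with slope a of the extremal function.  It is proved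
by induction on k.  A vertex of degree at least a can be deleted, so assume
that all degrees are at most D = a - 1.  Turan's theorem gives an independent
set of size p; take one, S, with the largest degree sum M.  By maximality a
vertex with exactly one neighbour s in S has degree at most deg s, and a vertex
without neighbour in S has degree at most th <= min deg on S; a vertex with at
least two neighbours in S is counted twice in M.  Double counting then bounds
e(F) in terms of M and shows that F - S satisfies the hypothesis for k - 1 and
a - 2.

The choice a = 7 gives the values 7 (n - 4 p + 1), and a = (n - 3) / (p - 1)
gives the Turan range.  The two values above the tangent, n = 4 p + 1 and
n = 4 p + 4, use the same double counting with small D.  The extremal graphs are
joins of a complete graph with a Turan graph, except for p = 3, n = 16. *)

(** * Degree sums and independent sets *)

Section Packing.
Variables (V : finType) (r : rel V).
Hypothesis r_sym : symmetric r.
Hypothesis r_irr : irreflexive r.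
Implicit Types (A B S : {set V}) (w : V -> nat).

Definition deg A x := #|[set y in A | r x y]|.
(** Twice the number of edges inside [A], so that no bound below needs a division. *)
Definition vol A := \sum_(x in A) deg A x.
Definition indep S := [forall x in S, forall y in S, ~~ r x y].

Lemma indepP S : reflect {in S &, forall x y, ~~ r x y} (indep S).
Proof.
apply: (iffP forall_inP) => h x; first by move=> y xS yS; have /forall_inP := h x xS; apply.
by move=> xS; apply/forall_inP => y yS; apply: h.
Qed.

Fixpoint packing k p A : Prop :=
  if k is k'.+1 then
    exists S, [/\ S \subset A, indep S, #|S| = p & packing k' p (A :\: S)]
  else True.

Lemma packingW k p A B : A \subset B -> packing k p A -> packing k p B.
Proof.
elim: k A B => //= k IHk A B sAB [S [sSA iS cS pk]].
by exists S; split=> //; [apply: subset_trans sAB | apply: IHk pk; apply: setSD].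
Qed.

Lemma degE A x : deg A x = \sum_(y in A) r x y.
Proof.
rewrite /deg -sum1_card big_mkcond [RHS]big_mkcond; apply: eq_bigr => y _.
by rewrite inE; case: (y \in A) => //=; case: (r x y).
Qed.

Lemma degS A B x : A \subset B -> deg A x <= deg B x.
Proof.
move=> sAB; apply: subset_leq_card; apply/subsetP => y; rewrite !inE.
by case/andP=> /(subsetP sAB) -> ->.
Qed.

Lemma deg_split A S x : S \subset A -> deg A x = deg S x + deg (A :\: S) x.
Proof.
move=> sSA; rewrite !degE (big_setID S) /=; congr (_ + _).
by move/setIidPr: sSA => ->.
Qed.

Lemma sum_deg_sym A B w :
  \sum_(x in A) \sum_(y in B | r x y) w y = \sum_(y in B) deg A y * w y.
Proof.
under eq_bigr do rewrite big_mkcondr /=.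
rewrite exchange_big /=; apply: eq_bigr => y _.
rewrite degE big_distrl /=; apply: eq_bigr => x _.
by rewrite r_sym; case: (r y x); rewrite ?mul1n.
Qed.

Lemma deg_indep S x : indep S -> x \in S -> deg S x = 0.
Proof.
move=> /indepP iS xS; apply: eq_card0 => y; rewrite !inE.
by apply/negP => /andP [yS]; apply/negP; apply: iS.
Qed.

Lemma indep_deg S A x : indep S -> S \subset A -> x \in S ->
  deg (A :\: S) x = deg A x.
Proof. by move=> iS sSA xS; rewrite (deg_split x sSA) (deg_indep iS xS). Qed.

Lemma sum_deg_indep S A : indep S -> S \subset A ->
  \sum_(v in A :\: S) deg S v = \sum_(s in S) deg A s.
Proof.
move=> iS sSA; transitivity (\sum_(x in A :\: S) \sum_(y in S | r x y) 1).
  apply: eq_bigr => x _; rewrite degE big_mkcondr; apply: eq_bigr => y _.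
  by case: (r x y).
rewrite (sum_deg_sym _ _ (fun=> 1)); apply: eq_bigr => y yS.
by rewrite muln1 indep_deg.
Qed.

Lemma vol_indep S A : indep S -> S \subset A ->
  vol A = vol (A :\: S) + 2 * \sum_(x in S) deg A x.
Proof.
move=> iS sSA; rewrite /vol (big_setID S) /=.
move/setIidPr: (sSA) => ->.
have -> : \sum_(x in A :\: S) deg A x =
   \sum_(x in A :\: S) deg (A :\: S) x + \sum_(x in S) deg A x.
  under eq_bigr do rewrite (deg_split _ sSA).
  by rewrite big_split /= addnC sum_deg_indep.
lia.
Qed.

Lemma indep1 v : indep [set v].
Proof. by apply/indepP => x y /set1P -> /set1P ->; rewrite r_irr. Qed.

Lemma vol_del1 A v : v \in A -> vol A = vol (A :\ v) + 2 * deg A v.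
Proof.
by move=> vA; rewrite (vol_indep (indep1 v)) ?sub1set // big_set1.
Qed.

Lemma volS A B : A \subset B -> vol A <= vol B.
Proof.
move=> sAB; rewrite /vol [X in _ <= X](big_setID A) /=.
move/setIidPr: (sAB) => ->; apply: leq_trans (leq_addr _ _).
by apply: leq_sum => x _; apply: degS.
Qed.

Definition nbhd A v := v |: [set y in A | r v y].

Lemma card_nbhd A v : #|nbhd A v| = (deg A v).+1.
Proof. by rewrite /nbhd cardsU1 inE r_irr andbF. Qed.

Lemma nbhd_sub A v : v \in A -> nbhd A v \subset A.
Proof.
by move=> vA; apply/subsetP => y; rewrite !inE => /orP [/eqP -> | /andP []].
Qed.

Lemma indepU1 A S v : indep S -> S \subset A :\: nbhd A v -> indep (v |: S).
Proof.
move=> /indepP iS /subsetP sS; apply/indepP.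
have vS y : y \in S -> ~~ r v y.
  by move/sS; rewrite !inE negb_or; case: (y \in A); rewrite ?andbF //= andbT => /andP [].
move=> x y; rewrite !inE => /orP [/eqP -> | xS] /orP [/eqP -> | yS].
- by rewrite r_irr.
- exact: vS.
- by rewrite r_sym vS.
- exact: iS.
Qed.

(** Turan's theorem in tangent form. Delete the closed neighbourhood of a vertex of minimum degree
    d: its d + 1 vertices have degree at least d, so the volume falls by at least d (d + 1). *)
Lemma indep_exists_of_vol P a A :
  vol A + P * (a * a.+1) < 2 * a * #|A| ->
  exists S, [/\ S \subset A, indep S & #|S| = P.+1].
Proof.
elim: P A => [|P IHP] A hA.
  have /card_gt0P [v vA] : 0 < #|A| by case: #|A| hA => //; lia.
  by exists [set v]; rewrite sub1set vA indep1 cards1.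
have /card_gt0P [v0 v0A] : 0 < #|A| by case: #|A| hA => //; lia.
case: (@arg_minnP _ v0 (fun x => x \in A) (deg A) v0A) => v vA vmin.
set B := A :\: nbhd A v; set d := deg A v in vmin.
have cB : #|A| = #|B| + d.+1.
  by rewrite -(cardsID (nbhd A v) A) (setIidPr (nbhd_sub vA)) card_nbhd addnC.
have vB : vol B + d * d.+1 <= vol A.
  rewrite {2}/vol (big_setID (nbhd A v)) /= (setIidPr (nbhd_sub vA)) addnC.
  apply: leq_add.
    rewrite mulnC -(card_nbhd A v) -sum_nat_const; apply: leq_sum => x xN.
    by apply: vmin; apply: (subsetP (nbhd_sub vA)).
  by apply: leq_sum => x _; apply: degS; apply: subsetDl.
(* Right minus left is (a - d)(a - d - 1), a product of consecutive integers. *)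
have tangent : 2 * a * d.+1 <= d * d.+1 + a * a.+1.
  by have [] := leqP a d; nia.
have [] := IHP B; first by rewrite cB mulnDr mulSn in hA; lia.
move=> S [sS iS cS]; exists (v |: S); split.
- by rewrite subUset sub1set vA; apply: subset_trans sS (subsetDl _ _).
- exact: indepU1 sS.
- rewrite cardsU1 cS; case: (boolP (v \in S)) => // /(subsetP sS).
  by rewrite !inE eqxx.
Qed.

(** * Double counting around an independent set of maximum weight *)

Lemma indep_swap S v s : indep S -> s \in S ->
  (forall t, t \in S -> r v t -> t = s) -> indep (v |: S :\ s).
Proof.
move=> /indepP iS sS h; apply/indepP.
have vS y : y \in S :\ s -> ~~ r v y.
  by rewrite !inE => /andP [ys yS]; apply: contra ys => /(h y yS) ->.
move=> x y; rewrite 2!inE [y \in _]inE inE => /orP [/eqP -> | xS] /orP [/eqP -> | yS].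
- by rewrite r_irr.
- exact: vS.
- by rewrite r_sym vS.
- by case/setD1P: xS => _ xS; case/setD1P: yS => _ yS; apply: iS.
Qed.

(** The last clause comes from exchanging [s] for [v]. It also covers a [v] without neighbours in
    [S], and then holds for every [s]. *)
Lemma max_weight_indep w A p :
  (exists S, [/\ S \subset A, indep S & #|S| = p]) ->
  exists S, [/\ S \subset A, indep S, #|S| = p,
    (forall S', S' \subset A -> indep S' -> #|S'| = p ->
       \sum_(x in S') w x <= \sum_(x in S) w x)
    & forall v s, v \in A :\: S -> s \in S ->
        (forall t, t \in S -> r v t -> t = s) -> w v <= w s].
Proof.
case=> S0 [sS0 iS0 cS0].
pose Q S := [&& S \subset A, indep S & #|S| == p].
have QS0 : Q S0 by rewrite /Q sS0 iS0 cS0 eqxx.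
case: (@arg_maxnP _ S0 Q (fun S => \sum_(x in S) w x) QS0) => S /and3P [sS iS /eqP cS] Smax.
exists S; split=> // [S' sS' iS' cS' | v s].
  by apply: Smax; rewrite /Q sS' iS' cS' eqxx.
rewrite inE => /andP [vS vA] sS' h.
have vSs : v \notin S :\ s by rewrite inE (negPf vS) andbF.
have /Smax : Q (v |: S :\ s).
  rewrite /Q indep_swap // andTb subUset sub1set vA /= cardsU1 vSs -cS.
  by rewrite (cardsD1 s S) sS' eqxx andbT (subset_trans (subsetDl _ _)).
by rewrite big_setU1 //= (big_setD1 s sS') /=; lia.
Qed.

(* Charge each vertex v outside S. If v has a single neighbour s in S, then
   deg v <= deg s; if it has at least two, then deg v <= D is cheap because v
   is counted at least twice in the sum of the degrees over S. *)
Lemma vol_le_of_local_max A S D th :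
  S \subset A -> indep S -> th <= D ->
  (forall x, x \in A -> deg A x <= D) ->
  (forall v, v \in A :\: S -> deg S v = 0 -> deg A v <= th) ->
  (forall v s, v \in A :\: S -> s \in S ->
     (forall t, t \in S -> r v t -> t = s) -> deg A v <= deg A s) ->
  2 * vol A + \sum_(s in S) deg A s * minn (2 * (D - deg A s)) (D - th)
    <= 2 * (D + 1 - th) * \sum_(s in S) deg A s + 2 * th * (#|A| - #|S|).
Proof.
move=> sSA iS thD degD degU deg1.
(* Slack granted by each neighbour [s] of [v]: the first term of the minimum is what a single
   neighbour can spare in [pt], the second what each of several neighbours can. *)
pose ka s := minn (2 * (D - deg A s)) (D - th).
have pt v : v \in A :\: S ->
    2 * deg A v + \sum_(s in S | r v s) ka s <= 2 * (D - th) * deg S v + 2 * th.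
  move=> vAS; have vA : v \in A by case/setDP: vAS.
  have card_N : deg S v = #|[set s in S | r v s]| by [].
  have sumE : \sum_(s in S | r v s) ka s = \sum_(s in [set s in S | r v s]) ka s.
    by apply: eq_bigl => s; rewrite inE.
  case e : (deg S v) => [|[|m]].
  - have := degU v vAS e; rewrite big_pred0; first by lia.
    move=> s; apply/negP => sN; have := card0_eq e s.
    by rewrite !inE sN.
  - have /cards1P [s es] : #|[set s in S | r v s]| == 1 by rewrite -card_N e.
    rewrite sumE es big_set1; have : s \in [set s] by rewrite inE.
    rewrite -{1}es inE => /andP [sS rvs].
    have h : deg A v <= deg A s.
      by apply: deg1 => // t tS rvt; apply/set1P; rewrite -es inE tS.
    have := degD s (subsetP sSA s sS); rewrite /ka; lia.
  - have h : \sum_(s in S | r v s) ka s <= m.+2 * (D - th).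
      rewrite sumE -e card_N -sum_nat_const; apply: leq_sum => s _; exact: geq_minr.
    by have := degD v vA; nia.
have : 2 * \sum_(v in A :\: S) deg A v + \sum_(y in S) deg (A :\: S) y * ka y
    <= 2 * (D - th) * \sum_(v in A :\: S) deg S v + #|A :\: S| * (2 * th).
  rewrite -(sum_deg_sym (A :\: S)) !big_distrr -sum_nat_const -!big_split /=.
  by apply: leq_sum => v; apply: pt.
have -> : \sum_(y in S) deg (A :\: S) y * ka y = \sum_(y in S) deg A y * ka y.
  by apply: eq_bigr => y yS; rewrite indep_deg.
rewrite sum_deg_indep //.
have -> : #|A :\: S| = #|A| - #|S| by rewrite cardsD (setIidPr sSA).
have -> : vol A = \sum_(s in S) deg A s + \sum_(v in A :\: S) deg A v.
  by rewrite /vol (big_setID S) /= (setIidPr sSA).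
rewrite -[\sum_(s in S) deg A s * minn _ _]/(\sum_(s in S) deg A s * ka s).
move: (\sum_(s in S) _ * ka s) (\sum_(s in S) deg A s) (\sum_(v in _) deg A v).
have -> : D + 1 - th = (D - th) + 1 by rewrite addnBAC.
move: (D - th) (#|A| - #|S|) => u n K M W; nia.
Qed.

Lemma exists_indep_vol_le A p D :
  (exists S, [/\ S \subset A, indep S & #|S| = p]) ->
  (forall x, x \in A -> deg A x <= D) ->
  exists S th, [/\ S \subset A, indep S, #|S| = p,
    (forall s, s \in S -> th <= deg A s) /\ th <= D &
  2 * vol A + \sum_(s in S) deg A s * minn (2 * (D - deg A s)) (D - th)
    <= 2 * (D + 1 - th) * \sum_(s in S) deg A s + 2 * th * (#|A| - p)].
Proof.
move=> exS degD; case: (max_weight_indep (deg A) exS) => S [sSA iS cS _ hS].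
(* An empty maximum is 0, so [th] is 0 if every vertex outside [S] has a neighbour in [S]. *)
pose th := \max_(v in A :\: S | deg S v == 0) deg A v.
exists S, th.
have thS s : s \in S -> th <= deg A s.
  move=> sS; apply/bigmax_leqP => v /andP [vAS /eqP d0]; apply: hS => // t tS rvt.
  by have := card0_eq d0 t; rewrite !inE tS rvt.
have thD : th <= D.
  by apply/bigmax_leqP => v /andP [/setDP [vA _] _]; apply: degD.
split=> //; rewrite -cS; apply: vol_le_of_local_max => // v vAS d0.
by apply: (bigmax_sup v) => //; rewrite vAS d0 eqxx.
Qed.

(** Termwise, with d the degree of [s], the excess is (D - d)(2 d - th) or D (d - th), depending on
    which term is the minimum. *)
Lemma sum_cost_ge A S D th :
  (forall s, s \in S -> th <= deg A s <= D) ->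
  th * (D * #|S|) <=
    \sum_(s in S) deg A s * minn (2 * (D - deg A s)) (D - th)
    + th * \sum_(s in S) deg A s.
Proof.
move=> hS; rewrite mulnA mulnC -sum_nat_const big_distrr -big_split /=.
apply: leq_sum => s /hS; rewrite /minn; move: (deg A s) => d.
by case: ifP => _ /andP [thd dD]; nia.
Qed.

Lemma exists_indep_vol_bound A p D :
  (exists S, [/\ S \subset A, indep S & #|S| = p]) ->
  (forall x, x \in A -> deg A x <= D) ->
  exists S th, let M := \sum_(s in S) deg A s in
  [/\ S \subset A, indep S, #|S| = p, th * p <= M /\ th <= D &
  2 * vol A + th * (D * p) + th * M + 2 * th * p <= 2 * (D + 1) * M + 2 * th * #|A|].
Proof.
move=> exS degD; have [S [th [sSA iS cS [thS thD] h]]] := exists_indep_vol_le exS degD.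
exists S, th => M; split=> //.
  split=> //; rewrite -cS mulnC -sum_nat_const; exact: leq_sum.
have h2 : th * (D * p) <=
    \sum_(s in S) deg A s * minn (2 * (D - deg A s)) (D - th) + th * M.
  by rewrite -cS; apply: sum_cost_ge => s sS; rewrite thS // degD // (subsetP sSA).
have pA : p <= #|A| by rewrite -cS subset_leq_card.
move: h; rewrite -/M; move: h2 pA; move: (\sum_(s in S) _) => K.
move=> h2 pA h.
have {h} : 2 * vol A + K + 2 * th * M + 2 * th * p
    <= 2 * (D + 1) * M + 2 * th * #|A|.
  by rewrite mulnBr mulnBl mulnBr in h; nia.
nia.
Qed.

(** * The tangent bound, by induction on the number of sets *)

Lemma packing_step_arith vol' M n b P k th :
  2 * k < b -> th <= b.+1 ->
  vol' + 2 * M + P * (b.+2 * b.+3) + 2 * b.+2 * k.+1 < 2 * b.+2 * (n + P.+1) ->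
  2 * (vol' + 2 * M) + th * (b.+1 * P.+1) + th * M + 2 * th * P.+1
    <= 2 * (b.+1 + 1) * M + 2 * th * (n + P.+1) ->
  vol' + P * (b * b.+1) + 2 * b * k < 2 * b * n.
Proof.
move=> kb thb h1 h2.
(* The slope drops from [b + 2] to [b], which costs 4 n. A large [M] pays for this and [h1]
   suffices; otherwise [M] falls short by [x + 1] and [h2] is used. *)
have [g|g] := leqP (2 * n) (M + P * b.+1 + 2 * k).
  by nia.
have [x ex] : exists x, 2 * n = M + P * b.+1 + 2 * k + x.+1.
  by exists (2 * n - (M + P * b.+1 + 2 * k)).-1; lia.
(* [h2] leaves [th] with coefficient 2 k + x - b, which is at most x - 1 because [2 * k < b]. *)
have h3 : 2 * vol' + th <= 2 * b * M + th * x by nia.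
have h4 : th * x <= b.+1 * x by rewrite leq_mul2r thb orbT.
have h5 : 2 * b * (2 * n) = 2 * b * (M + P * b.+1 + 2 * k + x.+1) by rewrite ex.
nia.
Qed.

Lemma card_setD_eq S A m p : S \subset A -> #|S| = p -> #|A| = m + p ->
  #|A :\: S| = m.
Proof. by move=> sSA cS cA; rewrite cardsD (setIidPr sSA) cS cA addnK. Qed.

Lemma packing_of_vol k a P A :
  2 * k < a -> vol A + P * (a * a.+1) + 2 * a * k < 2 * a * #|A| ->
  packing k.+1 P.+1 A.
Proof.
elim: k a A => [|k IHk] a A ka.
  rewrite muln0 addn0 => /indep_exists_of_vol [S [sS iS cS]].
  by exists S; split.
(* The inner induction on cardinality deletes a vertex of degree at least [a]: the volume drops by
   at least 2 a and the right-hand side by exactly 2 a. *)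
have [n] := ubnP #|A|; elim: n A => // n IHn A cAn hA.
have [/existsP [v /andP [vA dv]] | noV] :=
    boolP [exists v, (v \in A) && (a <= deg A v)].
  have := cardsD1 v A; rewrite vA add1n => cA.
  apply: (packingW (subsetDl A [set v])); apply: IHn; first by lia.
  by move: hA; rewrite (vol_del1 vA) cA; nia.
have degA x : x \in A -> deg A x <= a.-1.
  move=> xA; have := negP noV; rewrite leqNgt => h; apply/negP => lt.
  by apply: h; apply/existsP; exists x; rewrite xA; lia.
have exS : exists S, [/\ S \subset A, indep S & #|S| = P.+1].
  by apply: (@indep_exists_of_vol P a); lia.
have [S [th [sSA iS cS [_ thD] h]]] := exists_indep_vol_bound exS degA.
have cA : #|A| = #|A :\: S| + P.+1.
  by rewrite -(cardsID S A) (setIidPr sSA) cS addnC.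
exists S; split=> //.
case: a ka hA degA thD h {IHn noV exS} => [|[|b]]; [by lia | by lia | ] => ka hA degA thD h.
apply: (IHk b); first by lia.
apply: (@packing_step_arith _ (\sum_(s in S) deg A s) _ _ _ _ th); try lia.
- by rewrite -(vol_indep iS sSA) -cA.
- by rewrite -(vol_indep iS sSA) -cA; exact: h.
Qed.

(** * The orders 4p + 1 and 4p + 4, where the value may exceed the tangent *)

Lemma exists_indep_through A v P a : v \in A ->
  vol A + P * (a * a.+1) < 2 * a * (#|A| - (deg A v).+1) + 2 * deg A v ->
  exists S, [/\ S \subset A, indep S, #|S| = P.+2 & v \in S].
Proof.
move=> vA hv; have := vol_del1 vA.
have cA : #|A :\: nbhd A v| = #|A| - (deg A v).+1.
  by rewrite cardsD (setIidPr (nbhd_sub vA)) card_nbhd.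
have : vol (A :\: nbhd A v) <= vol (A :\ v).
  by apply: volS; apply: setDS; rewrite sub1set !inE eqxx.
rewrite -cA in hv => le1 e1.
have [|S [sS iS cS]] := @indep_exists_of_vol P a (A :\: nbhd A v); first by lia.
exists (v |: S); split; last by rewrite !inE eqxx.
- by rewrite subUset sub1set vA; apply: subset_trans sS (subsetDl _ _).
- exact: indepU1 sS.
- rewrite cardsU1 cS; case: (boolP (v \in S)) => // /(subsetP sS).
  by rewrite !inE eqxx.
Qed.

Lemma leq_deg_sum A S v : v \in S -> deg A v <= \sum_(s in S) deg A s.
Proof. by move=> vS; rewrite (big_setD1 v vS) leq_addr. Qed.

Lemma large_degP A d :
  (exists2 v, v \in A & d < deg A v) \/ (forall x, x \in A -> deg A x <= d).
Proof.
have [/existsP [v /andP [vA dv]] | noV] :=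
    boolP [exists v, (v \in A) && (d < deg A v)]; first by left; exists v.
right=> x xA; rewrite leqNgt; apply: contra noV => lt.
by apply/existsP; exists x; rewrite xA.
Qed.

(** Slope 3 handles the last two sets once the volume is below 6. A set through a vertex of degree
    at least 3 achieves this; otherwise double counting with D = 2 does, since a positive [th]
    forces a degree sum of at least [p]. *)
Lemma packing3 p A : 3 <= p -> #|A| = 3 * p -> vol A < 12 -> packing 3 p A.
Proof.
case: p => [|P] // hP cA hA.
suff [S [sSA iS cS hM]] : exists S, [/\ S \subset A, indep S, #|S| = P.+1 &
    vol A < 6 + 2 * \sum_(s in S) deg A s].
  have cAS : #|A :\: S| = 2 * P.+1 by apply: card_setD_eq sSA cS _; lia.
  have := vol_indep iS sSA => e.
  by exists S; split=> //; apply: (@packing_of_vol 1 3); rewrite ?cAS; lia.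
have [[v vA dv] | degA] := large_degP A 2.
  case: P hP cA => [|P] // hP cA.
  have := vol_del1 vA => e.
  have [|S [sSA iS cS vS]] := @exists_indep_through A v P 1 vA; first by lia.
  by exists S; split=> //; have := leq_deg_sum A vS; lia.
have exS : exists S, [/\ S \subset A, indep S & #|S| = P.+1].
  by apply: (@indep_exists_of_vol P 3); lia.
have [S [th [sSA iS cS [thM _] h]]] := exists_indep_vol_bound exS degA.
exists S; split=> //.
move: thM h; move: (\sum_(s in S) deg A s) => M.
by case: th => [|th]; nia.
Qed.

(** A degree sum of 4 brings the volume below 12, as [packing3] requires. A vertex of degree at
    least 4 supplies it; otherwise D = 3. *)
Lemma packing4_card0 p A : 3 <= p -> #|A| = 4 * p -> vol A < 20 -> packing 4 p A.
Proof.
case: p => [|P] // hP cA hA.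
suff [S [sSA iS cS hM]] : exists S, [/\ S \subset A, indep S, #|S| = P.+1 &
    vol A < 12 + 2 * \sum_(s in S) deg A s].
  have cAS : #|A :\: S| = 3 * P.+1 by apply: card_setD_eq sSA cS _; lia.
  have := vol_indep iS sSA => e.
  by exists S; split=> //; apply: packing3 => //; lia.
have [[v vA dv] | degA] := large_degP A 3.
  case: P hP cA => [|P] // hP cA.
  have := vol_del1 vA => e.
  have [|S [sSA iS cS vS]] := @exists_indep_through A v P 1 vA; first by lia.
  by exists S; split=> //; have := leq_deg_sum A vS; lia.
have exS : exists S, [/\ S \subset A, indep S & #|S| = P.+1].
  by apply: (@indep_exists_of_vol P 3); lia.
have [S [th [sSA iS cS [thM _] h]]] := exists_indep_vol_bound exS degA.
exists S; split=> //.
move: thM h; move: (\sum_(s in S) deg A s) => M.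
have [|M3] := leqP 4 M; first by lia.
by case: th => [|[|th]]; nia.
Qed.

(** Deleting a vertex of degree at least 5 reduces to [packing4_card0]; otherwise D = 4, and slope 5
    yields the remaining three sets. *)
Lemma packing4_card1 p A :
  3 <= p -> #|A| = 4 * p + 1 -> vol A < 30 -> packing 4 p A.
Proof.
case: p => [|P] // hP cA hA.
have [[v vA dv] | degA] := large_degP A 4.
  have := cardsD1 v A; rewrite vA add1n => cAv; have := vol_del1 vA => e.
  by apply: (packingW (subsetDl A [set v])); apply: packing4_card0 => //; lia.
have exS : exists S, [/\ S \subset A, indep S & #|S| = P.+1].
  by apply: (@indep_exists_of_vol P 5); lia.
have [S [th [sSA iS cS [thM _] h]]] := exists_indep_vol_bound exS degA.
have cAS : #|A :\: S| = 3 * P.+1 + 1 by apply: card_setD_eq sSA cS _; lia.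
have := vol_indep iS sSA => e.
exists S; split=> //; apply: (@packing_of_vol 2 5) => //; rewrite cAS.
move: thM h e; move: (\sum_(s in S) deg A s) => M thM h e.
have [|M4] := leqP 5 M; first by lia.
have : vol (A :\: S) < 20; last by lia.
by case: th thM h => [|[|th]] thM h; nia.
Qed.

(** Serves for 4p + 4 vertices: [H] is what lies outside the closed neighbourhood of a vertex of
    degree 7, and [w] is the degree in the whole graph. *)
Lemma exists_heavy_indep w (H : {set V}) q : 3 <= q -> #|H| = 4 * q ->
  (forall x, x \in H -> deg H x <= w x <= 7) -> 14 <= \sum_(x in H) w x ->
  (exists S, [/\ S \subset H, indep S & #|S| = q]) ->
  exists S, [/\ S \subset H, indep S, #|S| = q & 4 <= \sum_(s in S) w s].
Proof.
move=> hq cH wH sumH exS.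
have [S [sSH iS cS Smax Sloc]] := max_weight_indep w exS.
exists S; split=> //; rewrite leqNgt; apply/negP; rewrite ltnS => wS.
have wSx s : s \in S -> w s <= \sum_(x in S) w x.
  by move=> sS; rewrite (big_setD1 s sS) leq_addr.
have inc : \sum_(v in H :\: S) deg S v <= 3.
  rewrite sum_deg_indep //; apply: leq_trans wS; apply: leq_sum => s sS.
  by case/andP: (wH s (subsetP sSH s sS)).
have single v : v \in H :\: S -> deg S v <= 1 -> exists2 s, s \in S & w v <= w s.
  move=> vHS; rewrite leq_eqVlt => /orP [/cards1P [s es] | ].
    have : s \in [set s] by rewrite inE.
    rewrite -{1}es inE => /andP [sS rvs]; exists s => //; apply: Sloc => // t tS rvt.
    by apply/set1P; rewrite -es inE tS.
  rewrite ltnS leqn0 => /eqP d0; have /card_gt0P [s sS] : 0 < #|S| by lia.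
  exists s => //; apply: Sloc => // t tS rvt.
  by have := card0_eq d0 t; rewrite !inE tS rvt.
(* If some weight in [S] is 0, outside vertices with no, one, or more neighbours in [S] weigh at
   most 0, 3, 7. With at most 3 edges leaving [S], the total is at most 3 + 10 < 14. *)
have [/existsP [s0 /andP [s0S /eqP w0]] | noz] := boolP [exists s in S, w s == 0].
  have : 2 * \sum_(v in H :\: S) w v <= 7 * \sum_(v in H :\: S) deg S v.
    rewrite !big_distrr /=; apply: leq_sum => v vHS.
    have /andP [_ wv7] : deg H v <= w v <= 7 by apply: wH; case/setDP: vHS.
    case e : (deg S v) => [|[|m]]; last by lia.
      have : w v <= w s0; last by lia.
      by apply: Sloc => // t tS rvt; have := card0_eq e t; rewrite !inE tS rvt.
    have [|s sS] := single v vHS; first by rewrite e.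
    by have := wSx s sS; lia.
  by move: sumH; rewrite (big_setID S) /= (setIidPr sSH); lia.
have w1 s : s \in S -> 0 < w s.
  move=> sS; rewrite lt0n; apply: contra noz => ws.
  by apply/existsP; exists s; rewrite sS.
(* All weights in [S] are now positive with sum at most 3, so [S] consists of three vertices of
   weight 1. *)
have q3 : q = 3.
  have : \sum_(s in S) 1 <= \sum_(s in S) w s by apply: leq_sum.
  by rewrite sum1_card; lia.
have ws1 s : s \in S -> w s <= 1.
  move=> sS; have : \sum_(t in S :\ s) 1 <= \sum_(t in S :\ s) w t.
    by apply: leq_sum => t /setD1P [_ /w1].
  have := cardsD1 s S; rewrite sum1_card sS (big_setD1 s sS) /= in wS *; lia.
have [/existsP [x /andP [xH wx]] | nox] := boolP [exists x in H, 2 <= w x]; last first.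
  have : \sum_(x in H) w x <= \sum_(x in H) 1.
    apply: leq_sum => x xH; rewrite leqNgt; apply: contra nox => wx.
    by apply/existsP; exists x; rewrite xH.
  by rewrite sum1_card; lia.
have big_deg y : y \in H -> 2 <= w y -> y \in H :\: S /\ 2 <= deg S y.
  move=> yH wy; have yHS : y \in H :\: S.
    by rewrite inE yH andbT; apply/negP => /ws1; lia.
  split=> //; rewrite leqNgt; apply/negP; rewrite ltnS => /(single y yHS) [s /ws1]; lia.
(* A weight of at least 2 uses two of the at most three edges leaving [S], so [x] is the only such
   vertex. *)
have [xHS dx] := big_deg x xH wx.
have others y : y \in H -> y != x -> w y <= 1.
  move=> yH yx; rewrite leqNgt; apply/negP => /(big_deg y yH) [yHS dy].
  move: inc; rewrite (big_setD1 x xHS) (big_setD1 y) /=; first by lia.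
  by rewrite !inE yx; rewrite inE in yHS.
have cHx := cardsD1 x H; rewrite xH in cHx.
have sumHx : \sum_(y in H :\ x) w y + w x = \sum_(y in H) w y.
  by rewrite (big_setD1 x xH) addnC.
have le11 B : B \subset H :\ x -> \sum_(y in B) w y <= #|B|.
  move=> sB; rewrite -sum1_card; apply: leq_sum => y /(subsetP sB) /setD1P [yx yH].
  exact: others.
have wx3 : 3 <= w x by have := le11 _ (subxx (H :\ x)); lia.
(* [R] has at least 4 vertices, so it contains nonadjacent [l] and [m]. The triple [x], [l], [m]
   weighs at most 3, hence [w x = 3], [w l = 0], and the total is at most 13. *)
pose R := H :\: nbhd H x.
have [dHx wx7] : deg H x <= w x /\ w x <= 7 by apply/andP; apply: wH.
have sRH : R \subset H by apply: subsetDl.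
have xR : x \notin R by rewrite !inE eqxx.
have cR : #|R| = 11 - deg H x.
  by rewrite cardsD (setIidPr (nbhd_sub xH)) card_nbhd; lia.
have /card_gt0P [l lR] : 0 < #|R| by lia.
have lH := subsetP sRH l lR.
have lx : l != x by apply: contraNneq xR => <-.
have wl := others l lH lx.
have dRl : deg R l <= 1.
  by apply: leq_trans wl; case/andP: (wH l lH) => dl _; apply: leq_trans (degS _ sRH) dl.
have /card_gt0P [m mR] : 0 < #|R :\: nbhd R l|.
  rewrite cardsD (setIidPr (nbhd_sub lR)) card_nbhd.
  by move: dRl cR dHx wx7; clear; lia.
have mRR : m \in R by case/setDP: mR.
have ml : m != l by apply: contraTneq mR => ->; rewrite !inE eqxx.
have im : indep (l |: [set m]).
  by apply: (@indepU1 R); [exact: indep1 | rewrite sub1set].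
have ilm : indep (x |: (l |: [set m])).
  apply: (@indepU1 H) => //; apply/subsetP => y; rewrite in_setU1 in_set1.
  by case/orP=> /eqP ->.
have xlm : x \notin l |: [set m].
  rewrite !inE negb_or eq_sym lx /=; apply: contraNneq xR => ->.
  by [].
have lm : l \notin [set m] by rewrite inE eq_sym.
have := Smax (x |: (l |: [set m])) _ ilm.
rewrite !cardsU1 xlm lm cards1 !big_setU1 //= big_set1 => /(_ _ _).
have -> : x |: (l |: [set m]) \subset H.
  apply/subsetP => y; rewrite !inE => /or3P [] /eqP -> //; exact: subsetP mRR.
move=> /(_ isT); rewrite q3 => /(_ erefl) hw.
have lHx : l \in H :\ x by rewrite !inE lx.
have e2 := le11 (H :\ x :\ l) (subsetDl _ _).
have e3 := cardsD1 l (H :\ x); rewrite lHx in e3.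
rewrite (big_setD1 l lHx) /= in sumHx.
by move: hw wS wx3 sumH sumHx e2 e3 cHx cH; rewrite q3; clear; lia.
Qed.

(** Slope 7 settles volume below 70 and any vertex of degree at least 8. Otherwise a set of degree
    sum at least 11 suffices: one through a vertex of degree 7, or, when D = 6, the double-counted
    set, whose sum cannot be smaller. *)
Lemma packing4_card4 p A :
  4 <= p -> #|A| = 4 * p + 4 -> vol A < 72 -> packing 4 p A.
Proof.
case: p => [|P] // hP cA hA.
have [hA' | vol70] := ltnP (vol A) 70.
  by apply: (@packing_of_vol 3 7); rewrite ?cA; lia.
have [[v vA dv] | deg7] := large_degP A 7.
  have := cardsD1 v A; rewrite vA add1n => cAv; have := vol_del1 vA => e.
  by apply: (packingW (subsetDl A [set v])); apply: (@packing_of_vol 3 7); lia.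
suff [S [sSA iS cS hM]] : exists S, [/\ S \subset A, indep S, #|S| = P.+1 &
    vol A < 50 + 2 * \sum_(s in S) deg A s].
  have cAS : #|A :\: S| = 3 * P.+1 + 4 by apply: card_setD_eq sSA cS _; lia.
  have := vol_indep iS sSA => e.
  by exists S; split=> //; apply: (@packing_of_vol 2 5); rewrite ?cAS; lia.
have [[v vA dv] | deg6] := large_degP A 6.
  have dv7 : deg A v = 7 by have := deg7 v vA; lia.
  have vol_v := vol_del1 vA; pose H := A :\: nbhd A v.
  have cH : #|H| = 4 * P.
    by rewrite cardsD (setIidPr (nbhd_sub vA)) card_nbhd dv7; lia.
  have volH : vol H <= vol (A :\ v).
    by apply: volS; apply: setDS; rewrite sub1set !inE eqxx.
  (* The weight needed is 11 - 7 = 4, and the total available is at least 70 - 8 * 7 = 14. *)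
  have [||||S [sS iS cS hS]] := @exists_heavy_indep (deg A) H P _ cH.
  - by lia.
  - move=> x /setDP [xA _]; rewrite deg7 // andbT; apply: degS; exact: subsetDl.
  - move: vol70; rewrite {1}/vol (big_setID (nbhd A v)) /= (setIidPr (nbhd_sub vA)).
    rewrite -/H; have : \sum_(x in nbhd A v) deg A x <= #|nbhd A v| * 7.
      rewrite -sum_nat_const; apply: leq_sum => x /(subsetP (nbhd_sub vA)).
      exact: deg7.
    by rewrite card_nbhd dv7; lia.
  - case: P hP cA cH => // P hP cA cH.
    by apply: (@indep_exists_of_vol P 5); lia.
  have vS : v \notin S by apply/negP => /(subsetP sS); rewrite !inE eqxx.
  exists (v |: S); split.
  - by rewrite subUset sub1set vA; apply: subset_trans sS (subsetDl _ _).
  - exact: indepU1 sS.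
  - by rewrite cardsU1 vS cS.
  - by rewrite big_setU1 //=; lia.
have exS : exists S, [/\ S \subset A, indep S & #|S| = P.+1].
  by apply: (@indep_exists_of_vol P 7); lia.
have [S [th [sSA iS cS [thS thD] h]]] := exists_indep_vol_le exS deg6.
exists S; split=> //.
have [|M10] := leqP 11 (\sum_(s in S) deg A s); first by lia.
have cost : th * (6 * P.+1) <=
    \sum_(s in S) deg A s * minn (2 * (6 - deg A s)) (6 - th)
    + th * \sum_(s in S) deg A s.
  by rewrite -cS; apply: sum_cost_ge => s sS; rewrite thS // deg6 // (subsetP sSA).
(* For [th = 0] and sum 10 the estimate stops exactly at 70. Zero cost would make every degree 0 or
   6, but 6 does not divide 10. *)
have cost10 : th = 0 -> \sum_(s in S) deg A s = 10 ->
    0 < \sum_(s in S) deg A s * minn (2 * (6 - deg A s)) (6 - th).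
  move=> -> sum10; rewrite lt0n; apply: contra_eqN sum10 => /eqP sum0.
  have d06 s : s \in S -> 6 %| deg A s.
    move=> sS; have := deg6 s (subsetP sSA s sS).
    move: sum0; rewrite (big_setD1 s sS) /= => /eqP; rewrite addn_eq0 => /andP [/eqP e _].
    by move: e; case: (deg A s) => [|[|[|[|[|[|[|]]]]]]].
  apply/eqP => e; have : 6 %| \sum_(s in S) deg A s by apply: dvdn_sum.
  by rewrite e.
move: M10 h cost cost10; rewrite cA.
move: (\sum_(s in S) deg A s) (\sum_(s in S) _ * _) => M K M10 h cost cost10; have h0 := h.
have {}h : 2 * vol A + th * (6 * P.+1) + th * M <= 14 * M + 2 * th * (3 * P.+1 + 4).
  move: h; have -> : 4 * P.+1 + 4 - P.+1 = 3 * P.+1 + 4 by lia.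
  have -> : 2 * (6 + 1 - th) * M = 14 * M - 2 * th * M by nia.
  by nia.
have {}h : 2 * vol A + th * M <= 14 * M + 8 * th by lia.
have [M8|M8] := leqP M 8; first by nia.
have [M9|M9] := leqP M 9; first by nia.
have eM : M = 10 by lia.
rewrite eM in h h0 cost10 *.
case: (posnP th) => [th0|]; last by lia.
by have := cost10 th0 erefl; rewrite th0 in h0; lia.
Qed.

End Packing.

(** * From packings in the complement to copies of K_p *)

Lemma packing_fun (V : finType) (r : rel V) k p (A : {set V}) : packing r k p A ->
  exists f : 'I_k -> 'I_p -> V,
    [/\ (forall i j i' j', f i j = f i' j' -> i = i' /\ j = j'),
        (forall i j, f i j \in A) & forall i j j', ~~ r (f i j) (f i j')].
Proof.
elim: k A => [|k IHk] A.
  by move=> _; unshelve eexists; [case | split; case].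
case=> S [sSA /indepP iS cS /IHk [g [g_inj gA g_ind]]].
pose h (x : 'I_p) := enum_val (cast_ord (esym cS) x).
have hS x : h x \in S by apply: enum_valP.
have h_inj : injective h by move=> x y /enum_val_inj /cast_ord_inj.
exists (fun i => if unlift ord0 i is Some j then g j else h); split.
- move=> i j i' j'.
  case: unliftP => [i1|] ->; case: unliftP => [i2|] ->.
  + by case/g_inj => -> ->.
  + by move=> e; have := gA i1 j; rewrite e inE hS.
  + by move=> e; have := gA i2 j'; rewrite -e inE hS.
  + by move/h_inj => ->.
- move=> i j; case: unliftP => [i1|] _; last exact: subsetP (hS j).
  by have := gA i1 j; case/setDP.
- by move=> i j j'; case: unliftP => [i1|] _; [apply: g_ind | apply: iS].
Qed.

Section Adjacency.
Variable V : finType.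
Implicit Types (G : sgraph V) (x y : V).

Lemma adj_sym G : symmetric (adj G).
Proof. by move=> x y; rewrite /adj setUC. Qed.

Lemma adj_irr G : irreflexive (adj G).
Proof.
move=> x; apply/negP; rewrite /adj setUid; case: G => E /= /forall_inP hE /hE.
by rewrite cards1.
Qed.

Lemma edgesP G e : e \in edges G -> exists x y, [/\ x != y, e = [set x; y] & adj G x y].
Proof.
move=> eG; have : #|e| == 2 by case: G eG => E /= /forall_inP hE /hE.
by case/cards2P => x [y [xy ee]]; exists x, y; rewrite /adj -ee.
Qed.

Definition nonadj G x y := (x != y) && ~~ adj G x y.

Lemma nonadj_sym G : symmetric (nonadj G).
Proof. by move=> x y; rewrite /nonadj eq_sym adj_sym. Qed.

Lemma nonadj_irr G : irreflexive (nonadj G).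
Proof. by move=> x; rewrite /nonadj eqxx. Qed.

Lemma set2_eq x y x' y' : [set x; y] = [set x'; y'] ->
  (x = x' /\ y = y') \/ (x = y' /\ y = x').
Proof.
move=> e; have := set21 x y; have := set22 x y.
rewrite e => /set2P h2 /set2P h1.
have := set21 x' y'; have := set22 x' y'; rewrite -e => /set2P h4 /set2P h3.
by case: h1 h2 h3 h4 => -> [] -> [] ? [] ?; subst; auto.
Qed.

Lemma adj_multipartite (c : V -> nat) x y :
  adj (complete_multipartite c) x y = (c x != c y).
Proof.
rewrite /adj inE; apply/existsP/idP => [[x' /existsP [y' /andP [cxy /eqP]]] | cxy].
  by case/set2_eq=> [] [-> ->] //; rewrite eq_sym.
by exists x; apply/existsP; exists y; rewrite cxy eqxx.
Qed.

End Adjacency.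

Lemma adj_copies k p (x y : 'I_k * 'I_p) :
  adj (copies k (K p)) x y = (x.1 == y.1) && (x.2 != y.2).
Proof.
apply/idP/andP.
  move=> xy; have neq : x != y by apply: contraTneq xy => ->; rewrite adj_irr.
  case/imset2P: xy => i e _ _ exy.
  have := set21 x y; have := set22 x y; rewrite exy => /imsetP [j _ ey] /imsetP [j' _ ex].
  by rewrite ex ey eqxx in neq *; split=> //; apply: contraNneq neq => /= ->.
case: x y => i j [i' j'] /= [/eqP <- jj]; apply/imset2P.
exists i [set j; j'] => //; first by rewrite inE cards2 jj.
by rewrite imsetU1 imset_set1.
Qed.

Lemma has_copiesP (V : finType) (G : sgraph V) k p :
  reflect (exists f : 'I_k -> 'I_p -> V,
      (forall i j i' j', f i j = f i' j' -> i = i' /\ j = j') /\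
      (forall i j j', j != j' -> adj G (f i j) (f i j')))
    (has_subgraph (copies k (K p)) G).
Proof.
apply: (iffP existsP) => [[f /andP [/injectiveP f_inj /forallP fadj]] | [f [f_inj fadj]]].
  exists (fun i j => f (i, j)); split=> [i j i' j' /f_inj [-> ->] // | i j j' jj].
  by have /forallP /(_ (i, j')) := fadj (i, j); rewrite adj_copies eqxx jj.
exists [ffun x => f x.1 x.2]; apply/andP; split.
  by apply/injectiveP => [[i j] [i' j']]; rewrite !ffunE /= => /f_inj [-> ->].
apply/forallP => [[i j]]; apply/forallP => [[i' j']]; rewrite adj_copies !ffunE /=.
by apply/implyP => /andP [/eqP <-]; apply: fadj.
Qed.

Lemma has_copies_of_packing (V : finType) (G : sgraph V) k p :
  packing (nonadj G) k p [set: V] -> has_subgraph (copies k (K p)) G.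
Proof.
case/packing_fun => f [f_inj _ f_ind]; apply/has_copiesP; exists f; split=> // i j j' jj.
have := f_ind i j j'; rewrite /nonadj negb_and !negbK => /orP [/eqP /f_inj [_ e] | //].
by rewrite e eqxx in jj.
Qed.

(** * Counting nonedges *)

Definition nonedges n (G : sgraph 'I_n) :=
  \sum_(x < n) \sum_(y < n | y < x) ~~ adj G x y.

Lemma sum_ord_lt n (x : 'I_n) (F : nat -> nat) :
  \sum_(y < n | y < x) F y = \sum_(0 <= y < x) F y.
Proof.
rewrite (big_nat_widen _ _ _ _ _ (ltnW (ltn_ord x))) big_mkord.
by apply: eq_bigl => y.
Qed.

Lemma nedges_sum n (G : sgraph 'I_n) :
  nedges G = \sum_(x < n) \sum_(y < n | y < x) adj G x y.
Proof.
pose L := [set u : 'I_n * 'I_n | (u.2 < u.1) && adj G u.1 u.2].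
have -> : nedges G = #|L|.
  have <- : #|[set [set u.1; u.2] | u in L]| = #|L|.
    apply: card_in_imset => [[x y] [x' y']]; rewrite !inE /= => /andP [lt _] /andP [lt' _].
    by case/set2_eq=> [] [ex ey]; subst => //; lia.
  congr #|pred_of_set _|; apply/setP => e; apply/idP/imsetP.
    case/edgesP => x [y [xy -> xyG]]; have [lt|lt|/val_inj e'] := ltngtP x y.
    - by exists (y, x); [rewrite inE /= lt adj_sym | rewrite setUC].
    - by exists (x, y); rewrite ?inE //= lt.
    - by rewrite e' eqxx in xy.
  by case=> [[x y]]; rewrite inE /= => /andP [_ xyG] ->.
rewrite pair_big_dep -sum1dep_card /= big_mkcondr; apply: eq_bigr => u _.
by case: (adj _ _ _).
Qed.

Lemma nedges_nonedges n (G : sgraph 'I_n) : nedges G + nonedges G = 'C(n, 2).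
Proof.
rewrite nedges_sum /nonedges -big_split -bin2_sum big_mkord /=.
apply: eq_bigr => x _; rewrite -big_split /= (eq_bigr (fun=> 1)).
  by rewrite (sum_ord_lt x (fun=> 1)) sum_nat_const_nat muln1 subn0.
by move=> y _; case: (adj _ _ _).
Qed.

Lemma vol_nonadj n (G : sgraph 'I_n) : vol (nonadj G) [set: 'I_n] = 2 * nonedges G.
Proof.
have -> : vol (nonadj G) [set: 'I_n] =
    \sum_(x < n) (\sum_(y < n | y < x) ~~ adj G x y + \sum_(y < n | x < y) ~~ adj G x y).
  rewrite /vol; apply: eq_big => [x | x _]; first by rewrite inE.
  rewrite degE big_mkcond [X in _ = X + _]big_mkcond [X in _ = _ + X]big_mkcond.
  rewrite -big_split; apply: eq_bigr => y _ /=.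
  rewrite inE /nonadj -val_eqE /=.
  by case: ltngtP => //=; rewrite ?addn0.
rewrite big_split /= mul2n -addnn; congr (_ + _).
rewrite (exchange_big_dep xpredT) //=; apply: eq_bigr => y _.
by apply: eq_bigr => x _; rewrite adj_sym.
Qed.

Lemma has_copies_of_vol n (G : sgraph 'I_n) k p m : nonedges G < m ->
  (forall r, symmetric r -> irreflexive r -> vol r [set: 'I_n] < 2 * m ->
     packing r k p [set: 'I_n]) ->
  has_subgraph (copies k (K p)) G.
Proof.
move=> hG h; apply: has_copies_of_packing; apply: h.
- exact: nonadj_sym.
- exact: nonadj_irr.
- by rewrite vol_nonadj; lia.
Qed.

Lemma ex_num_eq n k p m :
  (forall r, symmetric r -> irreflexive r -> vol r [set: 'I_n] < 2 * m ->
     packing r k p [set: 'I_n]) ->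
  (exists2 G : sgraph 'I_n, ~~ has_subgraph (copies k (K p)) G & nonedges G <= m) ->
  ex_num n (copies k (K p)) = 'C(n, 2) - m.
Proof.
move=> ub [G Gfree Gm]; apply/eqP; rewrite eqn_leq; apply/andP; split.
  apply/bigmax_leqP => G' G'free; have := nedges_nonedges G'.
  suff : m <= nonedges G' by lia.
  by rewrite leqNgt; apply: contra G'free => lt; apply: has_copies_of_vol ub.
apply: (@leq_trans (nedges G)); first by have := nedges_nonedges G; lia.
exact: (@leq_bigmax_cond _ (fun G => ~~ has_subgraph (copies k (K p)) G) _ G).
Qed.

(** * Lower bounds: Turan graphs, their joins, and the exceptional graph *)

Lemma sum_mod_eq q m k : k < q ->
  \sum_(0 <= y < m) (y %% q == k) = m %/ q + (k < m %% q).
Proof.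
move=> kq; have q0 : 0 < q by lia.
elim: m => [|m IHm]; first by rewrite big_geq // div0n mod0n.
rewrite big_nat_recr //= IHm.
have lt := ltn_pmod m q0; have e := divn_eq m q.
move: (m %/ q) (m %% q) lt e => d s lt e.
have [eq_q | lt_q] : s.+1 = q \/ s.+1 < q by lia.
  have -> : m.+1 = d.+1 * q by lia.
  by rewrite mulnK // modnMl; lia.
have -> : m.+1 = d * q + s.+1 by lia.
rewrite divnMDl // modnMDl modn_small // divn_small //; lia.
Qed.

(** The sum counts the pairs inside the classes of a Turan graph; [b = q] is allowed and makes all
    classes of size [a + 1]. *)
Lemma sum_divn q a b : b <= q ->
  2 * \sum_(0 <= x < a * q + b) x %/ q = q * (a * a.-1) + 2 * (a * b).
Proof.
move=> bq.
have block a' b' : b' <= q -> \sum_(a' * q <= x < a' * q + b') x %/ q = b' * a'.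
  move=> b'q; rewrite -{1}[a' * q]add0n big_addn addKn.
  rewrite -[X in _ = X * _]subn0 -sum_nat_const_nat; apply: eq_big_nat => x /andP [_ xb].
  by rewrite addnC divnMDl ?divn_small ?addn0 //; lia.
rewrite (@big_cat_nat _ _ _ (a * q)) ?leq_addr //= block //.
suff : 2 * \sum_(0 <= x < a * q) x %/ q = q * (a * a.-1) by lia.
elim: a => [|a IHa]; first by rewrite mul0n big_geq ?muln0.
have -> : a.+1 * q = a * q + q by lia.
rewrite (@big_cat_nat _ _ _ (a * q)) ?leq_addr //= block //.
by case: a IHa => [|a] IHa; nia.
Qed.

Section TuranJoin.
Variables (n N q : nat) (c : 'I_n -> nat).
Hypothesis q_gt0 : 0 < q.
(** Each colour [q + x] occurs once, so for [N <= n] this is the join of a Turan graph on [N]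
    vertices with a complete graph on the other [n - N]. *)
Hypothesis cE : forall x, c x = if x < N then x %% q else q + x.

Lemma nonedges_turan_join : N <= n ->
  nonedges (complete_multipartite c) = \sum_(0 <= x < N) x %/ q.
Proof.
move=> Nn; rewrite (big_nat_widen _ _ _ _ _ Nn) big_mkord /nonedges [RHS]big_mkcond.
apply: eq_bigr => x _ /=; case: ifP => xN.
  (* The nonneighbours of [x] below it are the earlier members of its residue class. *)
  have -> : x %/ q = \sum_(0 <= y < x) (y %% q == x %% q).
    by rewrite sum_mod_eq ?ltn_pmod // ltnn addn0.
  rewrite -(sum_ord_lt x (fun y => y %% q == x %% q)); apply: eq_bigr => y yx.
  by rewrite adj_multipartite !cE xN (ltn_trans yx xN) negbK eq_sym.
rewrite big1 // => y yx; rewrite adj_multipartite negbK !cE xN.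
have := ltn_pmod y q_gt0.
by case: ifP => _ ?; case: eqP => //; lia.
Qed.

(** A clique meets the first [N] vertices at most [q] times, so [k] disjoint cliques cover at most
    [k * q + (n - N)] vertices. *)
Lemma turan_join_free k p : k * q + (n - N) < k * p ->
  ~~ has_subgraph (copies k (K p)) (complete_multipartite c).
Proof.
move=> lt; apply/has_copiesP => [[f [f_inj fadj]]].
pose P := [set u : 'I_k * 'I_p | f u.1 u.2 < N].
have cP : #|P| <= k * q.
  pose h (u : 'I_k * 'I_p) := (u.1, Ordinal (ltn_pmod (f u.1 u.2) q_gt0)).
  have <- : #|h @: P| = #|P|.
    apply: card_in_imset => [[i j] [i' j']]; rewrite !inE /h /= => lti lti' [ei ec].
    subst i'; congr pair; apply/eqP; apply/negP => /negP jj.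
    by have := fadj i j j' jj; rewrite adj_multipartite !cE lti lti' ec eqxx.
  by apply: leq_trans (max_card _) _; rewrite card_prod !card_ord.
have cCP : #|~: P| <= n - N.
  pose g (u : 'I_k * 'I_p) := f u.1 u.2.
  have g_inj : injective g by move=> [i j] [i' j'] /f_inj /= [-> ->].
  rewrite -(card_imset _ g_inj).
  have : #|g @: ~: P| <= #|[set x : 'I_n | N <= x]|.
    apply: subset_leq_card; apply/subsetP => _ /imsetP [u uP ->].
    by rewrite inE leqNgt; move: uP; rewrite !inE.
  move/leq_trans; apply; rewrite -sum1dep_card.
  rewrite -(big_mkord (fun x => N <= x) (fun=> 1)) big_mkcond /=.
  have [nN | /ltnW Nn] := leqP n N.
    rewrite big_nat big1 // => x /andP [_ xn]; case: ifP => //; lia.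
  rewrite (@big_cat_nat _ _ _ N) //= big_nat big1 => [|x /andP [_ xN]]; last first.
    by case: ifP => //; lia.
  rewrite add0n big_nat (eq_bigr (fun=> 1)) => [|x /andP [-> _]] //.
  by rewrite -big_nat sum_nat_const_nat muln1.
have := cardsC P; rewrite card_prod !card_ord; lia.
Qed.

End TuranJoin.

Lemma turan_edgesE m q : 0 < q ->
  turan_edges m q + \sum_(0 <= x < m) x %/ q = 'C(m, 2).
Proof.
move=> q0; rewrite -(nedges_nonedges (turan_graph m q)); congr (_ + _).
by rewrite (@nonedges_turan_join _ m q) // => x; rewrite ltn_ord.
Qed.

Lemma ex_num_turan_join n N q k p a b m :
  0 < q -> N <= n -> k * q + (n - N) < k * p -> N = a * q + b -> b <= q ->
  2 * m = q * (a * a.-1) + 2 * (a * b) ->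
  (forall r, symmetric r -> irreflexive r -> vol r [set: 'I_n] < 2 * m ->
     packing r k p [set: 'I_n]) ->
  ex_num n (copies k (K p)) = 'C(n, 2) - m.
Proof.
move=> q0 Nn lt eN bq em ub; apply: ex_num_eq => //.
pose c (x : 'I_n) := if x < N then x %% q else q + x.
exists (complete_multipartite c); first by apply: (turan_join_free q0 _ lt).
have := sum_divn a bq; rewrite -eN -em (nonedges_turan_join q0 _ Nn) //; lia.
Qed.

(* K_8 + K_{1,7} on 16 vertices: the clique is {0, ..., 7} and the centre of the
   star is 8. Its complement is the extremal graph for p = 3, n = 16. *)
Definition clique_star (x y : nat) : bool :=
  [|| (x < 8) && (y < 8), (x == 8) && (8 < y) | (y == 8) && (8 < x)].

Lemma clique_star_graph_subproof :
  [forall e in [set e : {set 'I_16} | [exists x : 'I_16, exists y : 'I_16,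
     [&& x != y, ~~ clique_star x y & e == [set x; y]]]], #|e| == 2].
Proof.
apply/forall_inP => e; rewrite inE => /existsP [x /existsP [y /and3P [xy _ /eqP ->]]].
by rewrite cards2 xy.
Qed.

Definition clique_star_graph : sgraph 'I_16 := SGraph clique_star_graph_subproof.

Lemma adj_clique_star_graph x y :
  adj clique_star_graph x y = (x != y) && ~~ clique_star x y.
Proof.
rewrite /adj inE; apply/existsP/andP => [[x' /existsP [y' /and3P [xy h /eqP]]] | [xy h]].
  case/set2_eq=> [] [-> ->] //; rewrite eq_sym; split=> //.
  by apply: contra h; rewrite /clique_star; lia.
by exists x; apply/existsP; exists y; rewrite xy h eqxx.
Qed.

Lemma nonedges_clique_star_graph : nonedges clique_star_graph <= 35.
Proof.
(* Bounds the nonneighbours of [x] below it: 0 + ... + 7 = 28 in the clique, and one for each of the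
   7 leaves. *)
pose b (x : nat) := if x < 8 then x else (8 < x)%N : nat.
have : nonedges clique_star_graph <= \sum_(x < 16) b x.
  apply: leq_sum => x _; rewrite /b; have [x8 | x8] := ltnP x 8.
    apply: (@leq_trans (\sum_(y < 16 | y < x) 1)).
      by apply: leq_sum => y _; case: (adj _ _ _).
    by rewrite (sum_ord_lt x (fun=> 1)) sum_nat_const_nat; lia.
  apply: (@leq_trans (\sum_(y < 16 | y < x) ((y == 8 :> nat) && (8 < x)))).
    apply: leq_sum => y yx; rewrite adj_clique_star_graph /clique_star -val_eqE /=; lia.
  rewrite (sum_ord_lt x (fun y => (y == 8) && (8 < x))); case: (ltnP 8 x) => x8'; last first.
    by rewrite big1 // => y _; rewrite andbF.
  rewrite (big_cat_nat (n := 8) _ (ltnW x8')) //= big_nat big1 => [|y /andP [_ y8]]; last by lia.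
  rewrite big_ltn //= big_nat big1 => [|y /andP [y8 _]]; last by lia.
  by [].
by move/leq_trans; apply; rewrite -(big_mkord xpredT b) unlock.
Qed.

Lemma clique_star_graph_free : ~~ has_subgraph (copies 4 (K 3)) clique_star_graph.
Proof.
apply/has_copiesP => [[f [f_inj fadj]]].
pose g (u : 'I_4 * 'I_3) := f u.1 u.2.
have g_inj : injective g by move=> [i j] [i' j'] /f_inj /= [-> ->].
have low i j j' : j != j' -> f i j < 8 -> f i j' < 8 -> False.
  move=> jj h h'; have := fadj i j j' jj.
  by rewrite adj_clique_star_graph /clique_star h h' /= andbF.
(* Each triangle has at most one vertex below 8, so the twelve vertices include
   the centre 8, whose neighbours all lie below 8. *)
have [[i j] e8] : exists u, g u = 8 :> nat.
  pose P := [set u | g u < 8].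
  have cP : #|P| <= 4.
    have <- : #|[set u.1 | u in P]| = #|P|.
      apply: card_in_imset => [[i j] [i' j']]; rewrite !inE /g /= => h h' e; subst i'.
      by congr pair; apply/eqP; apply/negP => /negP jj; apply: low jj h h'.
    by apply: leq_trans (max_card _) _; rewrite card_ord.
  have [/existsP [u /eqP e] | no8] := boolP [exists u, g u == 8 :> nat]; first by exists u.
  have : #|g @: ~: P| <= #|[set x : 'I_16 | 8 < x]|.
    apply: subset_leq_card; apply/subsetP => _ /imsetP [u uP ->].
    have : g u != 8 :> nat by apply: contra no8 => e; apply/existsP; exists u.
    by move: uP; rewrite !inE; lia.
  have -> : #|[set x : 'I_16 | 8 < x]| = 7.
    by rewrite -sum1dep_card -(big_mkord (fun x => 8 < x) (fun=> 1)) unlock.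
  rewrite card_imset //.
  by have := cardsC P; rewrite card_prod !card_ord; lia.
have nb j' : j != j' -> f i j' < 8.
  move=> /(fadj i); rewrite adj_clique_star_graph /clique_star.
  by rewrite -val_eqE /= -[f i j]/(g (i, j)) e8; lia.
have [j1 [j2 [n1 n2 n12]]] : exists j1 j2 : 'I_3, [/\ j != j1, j != j2 & j1 != j2].
  case: j {e8 nb} => [[|[|[|]]]] // h.
  - by exists (inord 1), (inord 2); rewrite -!val_eqE /= !inordK.
  - by exists (inord 0), (inord 2); rewrite -!val_eqE /= !inordK.
  - by exists (inord 0), (inord 1); rewrite -!val_eqE /= !inordK.
exact: (low i j1 j2 n12 (nb _ n1) (nb _ n2)).
Qed.

Theorem theorem1p8 (p : nat) (hp : 3 <= p) :
  [/\ ex_num (4 * p + 1) (copies 4 (K p)) = 'C(4 * p + 1, 2) - 15,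
      ex_num (4 * p + 2) (copies 4 (K p)) = 'C(4 * p + 2, 2) - 21,
      ex_num (4 * p + 3) (copies 4 (K p)) = 'C(4 * p + 3, 2) - 28,
      (p = 3 -> ex_num (4 * p + 4) (copies 4 (K p)) = 'C(4 * p + 4, 2) - 35) /\
      (4 <= p -> ex_num (4 * p + 4) (copies 4 (K p)) = 'C(4 * p + 4, 2) - 36)
    & (forall n : nat, 4 * p + 5 <= n <= 7 * p - 2 ->
         ex_num n (copies 4 (K p)) = 'C(n, 2) - 7 * (n - 4 * p + 1)) /\
      (forall n : nat, 7 * p - 1 <= n ->
         ex_num n (copies 4 (K p)) = 3 + 3 * (n - 3) + turan_edges (n - 3) (p - 1))].
Proof.
have [P eP] : exists P, p = P.+1 by exists p.-1; lia.
have cT n : #|[set: 'I_n]| = n by rewrite cardsT card_ord.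
(* Slope 7 allows every [m] up to 7 (n - 4 p + 1). *)
have pk7 n m : 2 * m + 56 * p <= 14 * n + 14 ->
    forall r : rel 'I_n, symmetric r -> irreflexive r ->
    vol r [set: 'I_n] < 2 * m -> packing r 4 p [set: 'I_n].
  move=> hm r rs ri hv; rewrite eP.
  by apply: (packing_of_vol rs ri (a := 7)); rewrite ?cT; lia.
split; last split; last 1 first.
- move=> n hn.
  have q0 : 0 < p - 1 by lia.
  have eN := divn_eq (n - 3) (p - 1); have := ltn_pmod (n - 3) q0.
  have a7 : 7 <= (n - 3) %/ (p - 1) by rewrite leq_divRL //; lia.
  move: eN a7; move: (_ %/ _) (_ %% _) => a b eN a7 ltb.
  have em := sum_divn a (ltnW ltb); rewrite -eN in em.
  rewrite (ex_num_turan_join q0 _ _ eN (ltnW ltb) em); first 1 last; try lia.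
    move=> r rs ri; rewrite em => hv; rewrite eP.
    apply: (packing_of_vol rs ri (a := a)); first by lia.
    (* For this [n] the tangent of slope [a] passes exactly through the Turan value. *)
    rewrite cT; have en : n = a * P + b + 3 by nia.
    have hP1 : p - 1 = P by lia.
    rewrite hP1 in hv; move: (vol r _) hv => v hv; rewrite en.
    by case: a a7 hv {eN em en} => // a _ hv; nia.
  have := turan_edgesE (n - 3) q0.
  have : 'C(n, 2) = 3 + 3 * (n - 3) + 'C(n - 3, 2).
    have -> : n = (n - 3).+3 by lia.
    by rewrite !binS !bin1 !bin0 !subSS subn0; lia.
  by lia.
(* The complement is a single K_6 with isolated vertices; the later cases with one class use K_7,
   K_8 and K_9. *)
- apply: (@ex_num_turan_join _ 6 1 _ _ 6 0) => //; try lia.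
  by move=> r rs ri hv; apply: packing4_card1.
- apply: (@ex_num_turan_join _ 7 1 _ _ 7 0) => //; try lia.
  by apply: pk7; lia.
- apply: (@ex_num_turan_join _ 8 1 _ _ 8 0) => //; try lia.
  by apply: pk7; lia.
- split=> [e3 | p4].
    have := pk7 (4 * p + 4) 35; rewrite e3 => /(_ isT) pk; apply: ex_num_eq pk _.
    exists clique_star_graph; first exact: clique_star_graph_free.
    exact: nonedges_clique_star_graph.
  apply: (@ex_num_turan_join _ 9 1 _ _ 9 0) => //; try lia.
  by move=> r rs ri hv; apply: packing4_card4.
- move=> n /andP [hn hn'].
  (* With x = n - 4p + 1 and m = ceil(x / 4), the complement has 4m - x cliques
     K_7 and x - 3m cliques K_8. *)
  pose m := (n - 4 * p + 1 + 3) %/ 4.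
  apply: (@ex_num_turan_join _ (7 * m + (n - 4 * p + 1 - 3 * m)) m _ _ 7
    (n - 4 * p + 1 - 3 * m)); rewrite /m; try lia.
  by apply: pk7; lia.
Qed.
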